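(* Let $I=[0,1]$ or $I=[0,\infty)$ and let $X$ be a Banach function space on $I$ such that the Tandori function space $\widetilde X$ is nontrivial (i.e. $\widetilde X\ne\{0\}$). Then $\widetilde X$ contains an order isomorphically isometric copy of $\ell^\infty$.
   Context: $L^0(I)$ is the space of (a.e. equivalence classes of) real-valued Lebesgue measurable functions on $I$. A Banach function space $X$ on $I$ is a Banach space that is a linear subspace of $L^0(I)$ with the ideal property: $|f|\le|g|$ a.e., $f\in L^0(I)$, $g\in X$ imply $f\in X$ and $\|f\|_X\le\|g\|_X$; by convention $X$ is also assumed to contain a function positive a.e. on $I$ (this is not assumed for the derived space $\widetilde X$). Tandori space: $\widetilde X=\{f\in L^0(I):\widetilde f\in X\}$ with norm $\|f\|_{\widetilde X}=\|\widetilde f\|_X$, where $\widetilde f(x)=\operatorname{ess\,sup}_{t\in I,\,t\ge x}|f(t)|$ for $x\in I$. A Banach lattice $E$ contains an order isomorphically isometric copy of $\ell^\infty$ if there is a linear isometry of $\ell^\infty$ into $E$ that is an order (lattice) isomorphism onto its image. *)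

(* Defs.v *)
From HB Require Import structures.
From mathcomp Require Import all_boot all_order all_algebra.
From mathcomp Require Import all_classical all_reals all_analysis.
From mathcomp Require Import measurable_realfun ess_sup_inf.

Set Implicit Arguments.
Unset Strict Implicit.
Unset Printing Implicit Defensive.

Import Order.TTheory GRing.Theory Num.Theory.
Import numFieldNormedType.Exports.

Local Open Scope classical_set_scope.
Local Open Scope ring_scope.

(* The real line with the sigma-algebra of Lebesgue (not just Borel)
   measurable sets. *)
Definition lebesgueTypeR (R : realType) : Type :=
  caratheodory_type (@wlength R idfun)^*%mu.
HB.instance Definition _ (R : realType) := Measurable.on (lebesgueTypeR R).

Section L0.
Context {R : realType}.
Implicit Types i : interval R.

Lemma lebesgue_measurable_itv i : measurable ([set` i] : set (lebesgueTypeR R)).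
Proof. by apply: sub_caratheodory; exact: measurable_itv. Qed.

Definition lebesgue_on i : set (lebesgueTypeR R) -> \bar R :=
  mrestr (@completed_lebesgue_measure R) (lebesgue_measurable_itv i).
HB.instance Definition _ i := Measure.on (lebesgue_on i).

#[global] Instance lebesgue_on_filter i :
  Filter (nbhs (almost_everywhere (lebesgue_on i))).
Proof. exact: ae_filter_ringOfSetsType. Qed.

(* A class of functions on the interval [i] is encoded by functions on the
   whole line: [lebesgue_on i] is concentrated on [i], so that values outside
   of [i] are immaterial, and [{ae lebesgue_on i, ...}] means a.e. on [i]. *)
Definition L0 i := {mfun_ lebesgue_on i, lebesgueTypeR R >-> R}.
HB.instance Definition _ i := Choice.on (L0 i).
HB.instance Definition _ i := EqQuotient.on (L0 i).
Definition L0_fun i (f : L0 i) : R -> R := repr f.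
Coercion L0_fun : L0 >-> Funclass.

Section L0_lmodType.
Variable i : interval R.
Local Open Scope quotient_scope.
Local Notation mfunR := {mfun lebesgueTypeR R >-> R}.
Implicit Types (f g h : L0 i) (u v : mfunR) (a : R).

Lemma L0_eqP f g : {ae lebesgue_on i, forall x, f x = g x} <-> f = g.
Proof.
split=> [fg|->]; last exact: aeW.
rewrite -(reprK f) -(reprK g); apply/eqmodP/asboolP.
by apply: filterS fg => x fgx _.
Qed.

Lemma L0_piE u : {ae lebesgue_on i, forall x, (\pi_(L0 i) u : L0 i) x = u x}.
Proof.
have /eqmodP/asboolP : repr (\pi_(L0 i) u : L0 i) = u %[mod L0 i].
  by rewrite reprK.
by apply: filterS => x; apply.
Qed.

Definition L0_zero : L0 i := \pi_(L0 i) (0 : mfunR).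
Definition L0_opp f : L0 i := \pi_(L0 i) (- (repr f : mfunR)).
Definition L0_add f g : L0 i := \pi_(L0 i) ((repr f : mfunR) + repr g).
Definition L0_scale a f : L0 i := \pi_(L0 i) (a *: (repr f : mfunR)).

Lemma L0_zeroE : {ae lebesgue_on i, forall x, L0_zero x = 0}.
Proof. exact: L0_piE. Qed.

Lemma L0_oppE f : {ae lebesgue_on i, forall x, L0_opp f x = - f x}.
Proof. exact: L0_piE. Qed.

Lemma L0_addE f g : {ae lebesgue_on i, forall x, L0_add f g x = f x + g x}.
Proof. exact: L0_piE. Qed.

Lemma L0_scaleE a f : {ae lebesgue_on i, forall x, L0_scale a f x = a * f x}.
Proof. exact: L0_piE. Qed.

Let ae_and (P Q : R -> Prop) : {ae lebesgue_on i, forall x, P x} ->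
  {ae lebesgue_on i, forall x, Q x} -> {ae lebesgue_on i, forall x, P x /\ Q x}.
Proof. exact: filterI. Qed.

Let ae_imp (P Q : R -> Prop) : {ae lebesgue_on i, forall x, P x} ->
  (forall x, P x -> Q x) -> {ae lebesgue_on i, forall x, Q x}.
Proof. by move=> aeP PQ; exact: filterS PQ aeP. Qed.

Lemma L0_addA : associative L0_add.
Proof.
move=> f g h; apply/L0_eqP.
apply: ae_imp (ae_and (ae_and (L0_addE f (L0_add g h)) (L0_addE g h))
  (ae_and (L0_addE (L0_add f g) h) (L0_addE f g))) _ => x.
by move=> [[-> ->] [-> ->]]; rewrite addrA.
Qed.

Lemma L0_addC : commutative L0_add.
Proof. by move=> f g; rewrite /L0_add addrC. Qed.

Lemma L0_add0 : left_id L0_zero L0_add.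
Proof.
move=> f; apply/L0_eqP; apply: ae_imp (ae_and (L0_addE L0_zero f) L0_zeroE) _.
by move=> x [-> ->]; rewrite add0r.
Qed.

Lemma L0_addN : left_inverse L0_zero L0_opp L0_add.
Proof.
move=> f; apply/L0_eqP.
apply: ae_imp (ae_and (ae_and (L0_addE (L0_opp f) f) (L0_oppE f)) L0_zeroE) _.
by move=> x [[-> ->] ->]; rewrite addNr.
Qed.

HB.instance Definition _ :=
  GRing.isZmodule.Build (L0 i) L0_addA L0_addC L0_add0 L0_addN.

Lemma L0_scaleA a b f : L0_scale a (L0_scale b f) = L0_scale (a * b) f.
Proof.
apply/L0_eqP; apply: ae_imp (ae_and (L0_scaleE (a * b) f)
  (ae_and (L0_scaleE a (L0_scale b f)) (L0_scaleE b f))) _ => x.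
by move=> [-> [-> ->]]; rewrite mulrA.
Qed.

Lemma L0_scale1 : left_id 1 L0_scale.
Proof. by move=> f; rewrite /L0_scale scale1r reprK. Qed.

Lemma L0_scaleDr : right_distributive L0_scale +%R.
Proof.
move=> a f g; apply/L0_eqP.
apply: ae_imp (ae_and (ae_and (L0_scaleE a (f + g)) (L0_addE f g))
  (ae_and (L0_addE (L0_scale a f) (L0_scale a g))
          (ae_and (L0_scaleE a f) (L0_scaleE a g)))) _ => x.
by move=> [[-> ->] [-> [-> ->]]]; rewrite mulrDr.
Qed.

Lemma L0_scaleDl f : {morph L0_scale^~ f : a b / a + b}.
Proof.
move=> a b; apply/L0_eqP.
apply: ae_imp (ae_and (L0_scaleE (a + b) f)
  (ae_and (L0_addE (L0_scale a f) (L0_scale b f))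
          (ae_and (L0_scaleE a f) (L0_scaleE b f)))) _ => x.
by move=> [-> [-> [-> ->]]]; rewrite mulrDl.
Qed.

HB.instance Definition _ := GRing.Zmodule_isLmodule.Build R (L0 i)
  L0_scaleA L0_scale1 L0_scaleDr L0_scaleDl.

End L0_lmodType.

(* The linear subspace of L0 is given as a Banach space together with its
   inclusion into L0. *)
Record banach_function_space i := BanachFunctionSpace {
  bfs_sort :> completeNormedModType R ;
  bfs_incl : {linear bfs_sort -> L0 i} ;
  bfs_incl_inj : injective bfs_incl ;
  bfs_ideal : forall (f : L0 i) (g : bfs_sort),
    {ae lebesgue_on i, forall x, `|f x| <= `|(bfs_incl g : L0 i) x|} ->
    exists2 h : bfs_sort, bfs_incl h = f & `|h| <= `|g| ;
  bfs_pos : exists g : bfs_sort, {ae lebesgue_on i, forall x, 0 < (bfs_incl g : L0 i) x}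
}.

(* The essential supremum of |f| over the points t >= x of [i]. If these form
   a null set, this is -oo instead of 0; for the intervals [0, 1] and
   [0, +oo[ it can only happen for almost no x in [i]. *)
Definition tandori_maj i (f : L0 i) (x : R) : \bar R :=
  ess_sup (mrestr (lebesgue_on i) (lebesgue_measurable_itv `[x, +oo[))
          (fun t => `|f t|%:E).

Section tandori.
Variables (i : interval R) (X : banach_function_space i).

Definition is_tandori_maj (f : L0 i) (h : X) : Prop :=
  {ae lebesgue_on i, forall x, ((bfs_incl X h : L0 i) x)%:E = tandori_maj f x}.

Definition tandori : set (L0 i) := [set f | exists h : X, is_tandori_maj f h].

(* By injectivity of [bfs_incl], [xget] picks the only possible element. *)
Definition tandori_norm (f : L0 i) : R := `|xget 0 (is_tandori_maj f)|.

End tandori.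

Definition linfty : set (nat -> R) := [set u | bounded_fun u].

Definition linfty_norm (u : nat -> R) : R := sup (range (fun n => `|u n|)).

(* [E] is a sublattice of L0, so that the lattice operations of [E] are the
   pointwise ones. *)
Definition contains_linfty_copy i (E : set (L0 i)) (N : L0 i -> R) : Prop :=
  exists T : (nat -> R) -> L0 i,
    [/\ {in linfty, forall u, E (T u)},
        forall a, {in linfty &, forall u v, T (a *: u + v) = a *: T u + T v},
        {in linfty, forall u, N (T u) = linfty_norm u},
        {in linfty &, forall u v, (forall n, u n <= v n) <->
           {ae lebesgue_on i, forall x, T u x <= T v x}} &
        {in linfty &, forall u v,
           {ae lebesgue_on i, forall x,
              T (u \max v) x = Num.max (T u x) (T v x)} /\
           {ae lebesgue_on i, forall x,
              T (u \min v) x = Num.min (T u x) (T v x)}}].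

End L0.

(* Main.v *)
Require Import Defs.
From mathcomp Require Import all_boot all_order all_algebra.
From mathcomp Require Import all_classical all_reals all_analysis.
From mathcomp Require Import measurable_realfun ess_sup_inf.

Set Implicit Arguments.
Unset Strict Implicit.
Unset Printing Implicit Defensive.

(** The space contains a copy of l^oo because taking the least nonincreasing
    majorant of |f| forgets almost everything about f.

    If f <> 0 belongs to the Tandori space of X, then f does not vanish a.e. on
    [a, +oo[ for some a in ]0, 1], hence its majorant, which is nonincreasing
    and lies in X, is bounded below by a positive constant on [0, a[.  By the
    ideal property the indicator function of [0, a[ lies in X
    ([indic_in_bfs]).

    Partition [0, a[ into countably many measurable sets A_0, A_1, ... all of
    which accumulate at a in measure: every A_n meets every [x, a[ with x < a
    in a set of positive measure ([piece_cofinal]).  For a bounded sequence u,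
    the step function S u = sum_n u_n 1_(A_n) has |S u| <= sup |u_n| on [0, a[,
    and its essential supremum over [x, +oo[ is at least every |u_n| for every
    x < a, so that its majorant is (sup |u_n|) 1_[0, a[ ([tandori_maj_step]).
    Hence the Tandori norm of S u is the sup norm of u times the norm c^-1 of
    1_[0, a[ in X, and u |-> S (c u) is an isometry.  It is linear and a lattice
    homomorphism since S is defined pointwise, and it reflects the order since
    no A_n is null. *)

Import Order.TTheory GRing.Theory Num.Theory.
Import numFieldNormedType.Exports.

Local Open Scope classical_set_scope.
Local Open Scope ring_scope.

(** * Almost everywhere statements on an interval *)

Lemma ae_mrestr d (T : measurableType d) (R : realType)
    (mu : {measure set T -> \bar R}) (D : set T) (mD : measurable D)
    (P : T -> Prop) :
  {ae mrestr mu mD, forall x, P x} <-> {ae mu, forall x, D x -> P x}.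
Proof.
split=> -[N [mN N0 PN]].
- exists (N `&` D); split=> //; first exact: measurableI.
  by move=> x /= /not_implyP[Dx Px]; split=> //; exact: PN.
- exists (N `|` ~` D); split.
  + by apply: measurableU => //; exact: measurableC.
  + rewrite /mrestr setIUl setICl setU0.
    by apply: (subset_measure0 _ mN _ N0) => //; exact: measurableI.
  + move=> x /= nPx; have [Dx|] := pselect (D x); last by right.
    by left; apply: PN => /= /(_ Dx).
Qed.

Section lebesgue_on.
Context {R : realType}.
Implicit Types (I : interval R) (P : R -> Prop).

(** Intervals, and hence step functions, are Borel, but the elements of [L0] are
    represented by functions measurable for the completed sigma-algebra. *)
Lemma borel_measurable_lebesgue d (T : sigmaRingType d) (f : R -> T) :
  measurable_fun setT (f : measurableTypeR R -> T) ->
  measurable_fun setT (f : lebesgueTypeR R -> T).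
Proof.
move=> mf mT Y mY; rewrite setTI; apply: sub_caratheodory.
by rewrite -[X in measurable X]setTI; exact: mf.
Qed.

Lemma ae_on I : {ae lebesgue_on I, forall x, x \in I}.
Proof. by apply/ae_mrestr; exact: aeW. Qed.

Lemma ae_neq I (c : R) : {ae lebesgue_on I, forall x, x != c}.
Proof.
apply/ae_mrestr; exists [set c]; split.
- by rewrite -set_itv1; exact: lebesgue_measurable_itv.
- exact: (@lebesgue_measure_set1 R c).
- by move=> x /= /not_implyP[_ /negP]; rewrite negbK => /eqP.
Qed.

(** The form in which the positivity of the measure of an interval is used
    below: a property true almost everywhere is true somewhere in it. *)
Lemma ae_itv_ex I P (c d : R) : c < d -> {subset `[c, d[ <= I} ->
  {ae lebesgue_on I, forall x, P x} -> exists2 x, x \in `[c, d[ & P x.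
Proof.
move=> cd cdI /ae_mrestr[N [mN N0 PN]]; apply: contrapT => noP.
have : completed_lebesgue_measure [set` `[c, d[] = 0%E :> \bar R.
  apply: (subset_measure0 _ mN _ N0); first exact: lebesgue_measurable_itv.
  move=> x xcd; apply: PN => /= /(_ (cdI _ xcd)) Px.
  by apply: noP; exists x.
have := @lebesgue_measure_itv R `[c, d[.
rewrite /= lte_fin cd => h1 h2.
have : (d%:E - c%:E)%E = 0%E :> \bar R by rewrite -h1; exact: h2.
by rewrite -EFinB => -[] /eqP; rewrite subr_eq0 gt_eqF.
Qed.

(** The right endpoint of [[0, 1]] is excluded: the points of [I] to its right
    form a null set, for which the essential supremum is -oo. *)
Lemma ae_right_nbhd I : I = `[0, 1] \/ I = `[0, +oo[ ->
  {ae lebesgue_on I, forall x,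
    x \in I /\ exists2 d, x < d & {subset `[x, d[ <= I}}.
Proof.
move=> hI; apply: filterS2 (ae_on I) (ae_neq I 1) => x xI x1; split=> //.
case: hI xI => ->; rewrite in_itv/= => /andP[x0 x2].
  exists 1; first by rewrite lt_neqAle x1.
  move=> y; rewrite !in_itv/= => /andP[xy /ltW ->].
  by rewrite (le_trans x0).
exists (x + 1); first by rewrite ltrDl.
by move=> y; rewrite !in_itv/= => /andP[xy _]; rewrite (le_trans x0).
Qed.

End lebesgue_on.

(** * Pointwise values of classes of functions *)

Section L0_values.
Context {R : realType} {I : interval R}.

(** The values of [L0_zero], [L0_add] and [L0_scale], for the operations of
    the module [L0 I], so that they apply by rewriting to the latter. *)
Lemma L0_0fE : {ae lebesgue_on I, forall x, (0 : L0 I) x = 0}.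
Proof. exact: L0_zeroE. Qed.

Lemma L0_addfE (f g : L0 I) :
  {ae lebesgue_on I, forall x, (f + g : L0 I) x = f x + g x}.
Proof. exact: L0_addE. Qed.

Lemma L0_scalefE a (f : L0 I) :
  {ae lebesgue_on I, forall x, (a *: f : L0 I) x = a * f x}.
Proof. exact: L0_scaleE. Qed.

End L0_values.

(** * The least nonincreasing majorant *)

Section tandori_maj.
Context {R : realType} {I : interval R}.
Implicit Types f : L0 I.

Lemma tandori_maj_leP f x (y : \bar R) : (tandori_maj f x <= y)%E <->
  {ae lebesgue_on I, forall t, x <= t -> (`|f t|%:E <= y)%E}.
Proof.
split=> [/ess_supP/ae_mrestr|fy].
  by apply: filterS => t /= h xt; apply: h; rewrite in_itv/= xt.
apply/ess_supP/ae_mrestr; apply: filterS fy => t /= h.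
by rewrite in_itv/= andbT.
Qed.

Lemma tandori_maj_ge f x :
  {ae lebesgue_on I, forall t, x <= t -> (`|f t|%:E <= tandori_maj f x)%E}.
Proof. exact/tandori_maj_leP. Qed.

Lemma tandori_maj_nonincreasing f x y :
  x <= y -> (tandori_maj f y <= tandori_maj f x)%E.
Proof.
move=> xy; apply/tandori_maj_leP; apply: filterS (tandori_maj_ge f x) => t h yt.
by apply: h; exact: le_trans yt.
Qed.

Lemma tandori_maj_ge0 f x d : x < d -> {subset `[x, d[ <= I} ->
  (0 <= tandori_maj f x)%E.
Proof.
move=> xd /(ae_itv_ex xd) /(_ (tandori_maj_ge f x))[t].
by rewrite in_itv/= => /andP[xt _] /(_ xt); apply: le_trans; rewrite lee_fin.
Qed.

Lemma tandori_maj_eq0 f x d : x < d -> {subset `[x, d[ <= I} ->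
  {ae lebesgue_on I, forall t, x <= t -> f t = 0} -> tandori_maj f x = 0%E.
Proof.
move=> xd xdI f0; apply/eqP; rewrite eq_le (tandori_maj_ge0 _ xd)// andbT.
by apply/tandori_maj_leP; apply: filterS f0 => t h /h ->; rewrite normr0.
Qed.

(** Since [bfs_incl] is injective, [tandori_norm] can be computed from any
    element of [X] that represents the majorant. *)
Lemma is_tandori_maj_unique (X : banach_function_space I) (f : L0 I) (h k : X) :
  is_tandori_maj f h -> is_tandori_maj f k -> h = k.
Proof.
move=> fh fk; apply: (@bfs_incl_inj _ _ X); apply/L0_eqP.
by apply: filterS2 fh fk => x hx kx; apply: EFin_inj; rewrite hx kx.
Qed.

End tandori_maj.

(** * Step functions with levels accumulating at an endpoint *)

Section step.
Context {R : realType} (a : R).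
Implicit Types u v : nat -> R.

(** [(a - x)^-1] increases to +oo as x increases to a, so its integer part takes
    every large value on an interval close to a, and its 2-adic valuation takes
    each value n infinitely often.  The set A_n is the fiber over n. *)
Definition piece (x : R) : nat := logn 2 (Num.truncn (a - x)^-1).

Definition step (u : nat -> R) (x : R) : R :=
  if x \in `[0, a[ then u (piece x) else 0.

(** On ]-oo, a[ the integer part of [(a - x)^-1] is monotone, so its fibers are
    intervals; [step u] depends on x through it alone. *)
Lemma measurable_step (u : nat -> R) :
  measurable_fun setT (step u : measurableTypeR R -> R).
Proof.
pose D : set (measurableTypeR R) := [set` `]-oo, a[].
have mD : measurable D by exact: measurable_itv.
apply: measurable_fun_if => //.
- apply: (measurable_fun_bool true); rewrite setTI.
  rewrite [X in measurable X](_ : _ = [set` `[0, a[]); last first.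
    by apply/seteqP; split=> x.
  exact: measurable_itv.
- apply: (@measurable_funS _ _ _ _ D) => //.
    by move=> x [_] /=; rewrite !in_itv/= => /andP[].
  apply: (@measurable_comp _ _ _ _ nat R setT) => //.
  apply: (@measurable_comp _ _ _ _ nat nat setT) => //.
  move=> _ Y _.
  rewrite [X in measurable X](_ : _ = \bigcup_(k in Y)
     (D `&` [set x | Num.truncn (a - x)^-1 = k])); last first.
    apply/seteqP; split=> [x [Dx Yx]|x [k Yk [Dx xk]]].
      by exists (Num.truncn (a - x)^-1).
    by split=> //=; rewrite xk.
  apply: bigcup_measurable => k _; apply: is_interval_measurable.
  move=> x y [xa xk] [ya yk] z /andP[xz zy].
  rewrite /D/= !in_itv/= in xa ya *.
  have za : z < a by exact: le_lt_trans ya.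
  split=> //; apply/eqP; rewrite eqn_leq -{1}yk -xk.
  by rewrite !le_truncn// lef_pV2 ?posrE ?subr_gt0// lerB.
Qed.

(** An integer k of valuation n that exceeds [(a - x)^-1] gives the interval
    [a - 1/k, a - 1/(k+1)[, which lies in ]x, a[ and on which the integer part
    of [(a - t)^-1] is k. *)
Lemma piece_cofinal x n : x < a -> exists c d,
  [/\ x < c, c < d, d < a & forall t, t \in `[c, d[ -> piece t = n].
Proof.
move=> xa; pose m := Num.truncn (a - x)^-1.
pose k := (2 ^ n * (2 * m.+1).+1)%N.
have kn : logn 2 k = n.
  rewrite lognM ?expn_gt0// pfactorK// logn_coprime ?addn0//.
  by rewrite coprime2n oddS oddM.
have mk : (m < k)%N.
  rewrite /k (@leq_trans (2 * m.+1).+1)//.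
    by rewrite mul2n -addnn; apply: leqW; rewrite leq_addl.
  by rewrite leq_pmull// expn_gt0.
have k0 : 0 < k%:R :> R by rewrite ltr0n; exact: leq_trans mk.
have k10 : 0 < k.+1%:R :> R by rewrite ltr0n.
exists (a - k%:R^-1), (a - k.+1%:R^-1); split.
- rewrite ltrBrDr -ltrBrDl -[a - x]invrK ltf_pV2 ?posrE ?invr_gt0 ?subr_gt0//.
  by apply: lt_le_trans (truncnS_gt _) _; rewrite ler_nat.
- by rewrite ltrD2l ltrN2 ltf_pV2 ?posrE// ltr_nat.
- by rewrite ltrBlDr ltrDl invr_gt0.
- move=> t; rewrite in_itv/= => /andP[kt tk].
  have ta : 0 < a - t.
    by rewrite subr_gt0 (lt_trans tk)// ltrBlDr ltrDl invr_gt0.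
  rewrite /piece (@truncn_def _ _ k) //; apply/andP; split.
    rewrite -[k%:R]invrK lef_pV2 ?posrE ?invr_gt0//.
    by rewrite lerBlDr addrC -lerBlDr.
  rewrite -[k.+1%:R]invrK ltf_pV2 ?posrE ?invr_gt0//.
  by rewrite ltrBrDr addrC -ltrBrDr.
Qed.

End step.

(** * The sup norm of bounded sequences *)

Section linfty.
Context {R : realType}.
Implicit Types u v : nat -> R.

Lemma linfty_norm_ge u n : u \in linfty -> `|u n| <= linfty_norm u.
Proof.
rewrite inE => -[M [_ bM]]; apply: ub_le_sup; last by exists n.
(* boundedness is given by a filter at +oo: it bounds u by every number > M *)
exists (M + 1) => _ [k _ <-]; apply: bM => //.
by rewrite ltrDl.
Qed.

Lemma linfty_norm_le u M : (forall n, `|u n| <= M) -> linfty_norm u <= M.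
Proof.
move=> uM; apply: ge_sup; first by exists `|u 0|, 0.
by move=> _ [n _ <-].
Qed.

Lemma linfty_norm_ge0 u : u \in linfty -> 0 <= linfty_norm u.
Proof. by move=> /linfty_norm_ge - /(_ 0); apply: le_trans. Qed.

Lemma linftyZ c u : u \in linfty -> c *: u \in linfty.
Proof.
rewrite !inE => -[M [_ bM]]; exists (`|c| * (M + 1)); split.
  exact: num_real.
move=> x cMx n _ /=; rewrite normrM; apply: (le_trans _ (ltW cMx)).
by rewrite ler_wpM2l//; apply: bM => //; rewrite ltrDl.
Qed.

Lemma linfty_normZ c u : 0 < c -> u \in linfty ->
  linfty_norm (c *: u) = c * linfty_norm u.
Proof.
move=> c0 ub; apply/eqP; rewrite eq_le; apply/andP; split.
  apply: linfty_norm_le => n; rewrite normrM gtr0_norm//.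
  by rewrite ler_pM2l//; exact: linfty_norm_ge.
rewrite -ler_pdivlMl//; apply: linfty_norm_le => n; rewrite ler_pdivlMl//.
have := linfty_norm_ge n (linftyZ c ub).
by rewrite normrM gtr0_norm.
Qed.
End linfty.

(** * Step functions and indicators in the Tandori space *)

Section step_class.
Context {R : realType} {I : interval R}.
Context (hI : I = `[0, 1] \/ I = `[0, +oo[).
Implicit Types u v : nat -> R.

Local Open Scope quotient_scope.
Definition step_class a u : L0 I :=
  \pi_(L0 I) (mfun_Sub (mem_set
    (borel_measurable_lebesgue (measurable_step a u)))).

Lemma step_classE a u :
  {ae lebesgue_on I, forall x, step_class a u x = step a u x}.
Proof. exact: L0_piE. Qed.

Let ge0_of_mem x : x \in I -> 0 <= x.
Proof. by case: hI => ->; rewrite in_itv/= => /andP[]. Qed.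

(** Every level |u n| is attained on a non-null set to the right of any x < a,
    so the majorant does not decrease before a; the step function vanishes
    beyond a. *)
Lemma tandori_maj_step a u : {subset `[0, a[ <= I} -> u \in linfty ->
  {ae lebesgue_on I, forall x,
    (step a (cst (linfty_norm u)) x)%:E = tandori_maj (step_class a u) x}.
Proof.
move=> aI ub; apply: filterS (ae_right_nbhd hI) => x [xI [d xd xdI]].
have x0 := ge0_of_mem xI.
rewrite /step in_itv/= x0/=; case: ltP => xa; last first.
  apply/esym/(tandori_maj_eq0 xd xdI).
  apply: filterS (step_classE a u) => t -> xt.
  by rewrite /step in_itv/= [t < a]ltNge (le_trans xa xt) andbF.
apply/eqP; rewrite eq_le; apply/andP; split; last first.
  apply/tandori_maj_leP; apply: filterS (step_classE a u) => t -> _.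
  rewrite lee_fin /step; case: ifP => _; first exact: linfty_norm_ge.
  by rewrite normr0 linfty_norm_ge0.
have un n : (`|u n|%:E <= tandori_maj (step_class a u) x)%E.
  have [p [q [xp pq qa pn]]] := piece_cofinal n xa.
  have pI : {subset `[p, q[ <= I}.
    move=> t; rewrite in_itv/= => /andP[pt tq]; apply: aI.
    by rewrite in_itv/= (lt_trans tq qa) (le_trans x0)// (le_trans _ pt)// ltW.
  have [t tpq] := ae_itv_ex pq pI
    (filterI (tandori_maj_ge (step_class a u) x) (step_classE a u)).
  move: (tpq); rewrite in_itv/= => /andP[pt tq] [+ tE].
  rewrite tE /step in_itv/= (lt_trans tq qa) andbT pn//.
  by rewrite (le_trans x0)/= ?(le_trans (ltW xp) pt)//; apply.
move: un; case: (tandori_maj _ _) => [r un|_|/(_ 0%N)];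
  [|exact: leey|by rewrite leeNy_eq].
by rewrite lee_fin; apply: linfty_norm_le => n; have := un n; rewrite lee_fin.
Qed.

Context (X : banach_function_space I).

Lemma tandori0 : tandori X 0.
Proof.
exists 0; rewrite /is_tandori_maj linear0.
apply: filterS2 (ae_right_nbhd hI) L0_0fE => x [xI [d xd xdI]] ->.
apply/esym/(tandori_maj_eq0 xd xdI).
by apply: filterS L0_0fE => t.
Qed.

(** The majorant of [f] is at least its value at [a] on [0, a[, which is
    positive when [f] does not vanish a.e. beyond [a]; the ideal property
    applies to a multiple of it. *)
Lemma indic_in_bfs (f : L0 I) : tandori X f -> f <> 0 ->
  exists a, [/\ 0 < a, {subset `[0, a[ <= I} &
    exists h : X, bfs_incl X h = step_class a (cst 1)].
Proof.
move=> [h fh] f0.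
have [n nf] : exists n,
    ~ {ae lebesgue_on I, forall t, n.+1%:R^-1 <= t -> f t = 0}.
  apply: contrapT => /forallNP nf; apply: f0; apply/L0_eqP.
  have /ae_foralln : forall n,
      {ae lebesgue_on I, forall t, n.+1%:R^-1 <= t -> f t = 0}.
    by move=> n; apply: contrapT.
  move=> H; apply: filterS3 H (filterI (ae_on I) (ae_neq I 0)) L0_0fE.
  move=> x fx [xI x0] ->; apply: (fx (Num.truncn x^-1)).
  have xp : 0 < x by rewrite lt_neqAle eq_sym x0 ge0_of_mem.
  by rewrite invf_ple ?posrE//; exact: ltW (truncnS_gt _).
pose a : R := n.+1%:R^-1.
have a0 : 0 < a by rewrite invr_gt0.
have a1 : a <= 1 by rewrite invf_le1// ler1n.
exists a; split=> //.
  move=> x; case: hI => ->; rewrite !in_itv/= => /andP[-> xa]//=.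
  by rewrite ltW// (lt_le_trans xa).
have [e e0 ef] : exists2 e : R, 0 < e & (e%:E <= tandori_maj f a)%E.
  have : ~ (tandori_maj f a <= 0)%E.
    move=> /tandori_maj_leP f1; apply: nf; apply: filterS f1 => t /[apply].
    by rewrite lee_fin normr_le0 => /eqP.
  case: (tandori_maj f a) => [r|_|]; last by rewrite leNye.
  - by move=> /negP; rewrite -ltNge lte_fin => r0; exists r.
  - by exists 1 => //; exact: leey.
have [|k hk _] := @bfs_ideal _ _ X (step_class a (cst 1)) (e^-1 *: h).
  rewrite linearZ; apply: filterS3 (step_classE a (cst 1))
    (L0_scalefE e^-1 (bfs_incl X h)) fh => x -> -> hx.
  rewrite /step in_itv/=.
  case: ifP => [/andP[_ /ltW xa]|]; last by rewrite normr0.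
  rewrite normr1 normrM gtr0_norm ?invr_gt0// ler_pdivlMl// mulr1.
  apply: le_trans (ler_norm _); rewrite -lee_fin hx.
  exact: le_trans ef (tandori_maj_nonincreasing f xa).
by exists k.
Qed.

End step_class.

Theorem proposition4p8 (R : realType) (I : interval R)
    (hI : I = `[0, 1] \/ I = `[0, +oo[)
    (X : banach_function_space I)
    (hX : tandori X <> [set 0]) :
  contains_linfty_copy (tandori X) (tandori_norm X).
Proof.
have [f Xf f0] : exists2 f, tandori X f & f <> 0.
  apply: contrapT => noX; apply: hX; apply/seteqP; split=> f /=.
    by move=> Xf; apply: contrapT => f0; apply: noX; exists f.
  by move=> ->; exact: tandori0.
have [a [a0 aI [h hE]]] := indic_in_bfs hI Xf f0.
have ex_piece (P : R -> Prop) n : {ae lebesgue_on I, forall x, P x} ->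
    exists x, [/\ x \in `[0, a[, piece a x = n & P x].
  move=> aeP; have [p [q [p0 pq qa pn]]] := piece_cofinal n a0.
  have pqa : {subset `[p, q[ <= `[0, a[}.
    move=> t; rewrite !in_itv/= => /andP[pt tq].
    by rewrite (lt_trans tq qa) (le_trans (ltW p0) pt).
  have pqI : {subset `[p, q[ <= I} by move=> t /pqa /aI.
  by have [t tpq Pt] := ae_itv_ex pq pqI aeP; exists t; split; auto.
have h0 : 0 < `|h|.
  rewrite normr_gt0; apply/eqP => h0; move: hE; rewrite h0 linear0 => /esym E0.
  have [x [xa _ []]] := ex_piece _ 0%N
    (filterI (step_classE a (cst 1)) L0_0fE).
  by rewrite -E0 => -> /eqP; rewrite /step xa oner_eq0.
(* the indicator function of [0, a[ is normalized *)
pose c := `|h|^-1.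
have c0 : 0 < c by rewrite invr_gt0.
have TE (u : nat -> R) : u \in linfty ->
    is_tandori_maj (step_class a (c *: u)) ((c * linfty_norm u) *: h).
  move=> ub; rewrite /is_tandori_maj linearZ/= hE -linfty_normZ//.
  apply: filterS3 (tandori_maj_step hI aI (linftyZ c ub))
    (step_classE a (cst 1))
    (L0_scalefE (linfty_norm (c *: u)) (step_class a (cst 1))) => x <- hx ->.
  by rewrite hx /step; case: ifP; rewrite ?mulr1 ?mulr0.
exists (fun u => step_class a (c *: u)); split.
- by move=> u ub; exists ((c * linfty_norm u) *: h); exact: TE.
- move=> b u v ub vb; apply/L0_eqP.
  apply: filterS2 (filterI (step_classE a (c *: (b *: u + v)))
      (L0_addfE (b *: step_class a (c *: u)) (step_class a (c *: v))))
    (filterI (L0_scalefE b (step_class a (c *: u)))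
      (filterI (step_classE a (c *: u)) (step_classE a (c *: v)))).
  move=> x [-> ->] [-> [-> ->]]; rewrite /step; case: ifP => _ /=.
    by rewrite -[LHS]/(c * (b * u _ + v _)) mulrDr mulrCA.
  by rewrite mulr0 addr0.
- move=> u ub; rewrite /tandori_norm.
  rewrite (xget_unique _ (TE _ ub)) => [|k uk]; last first.
    exact: is_tandori_maj_unique uk (TE _ ub).
  rewrite normrZ ger0_norm; last by rewrite mulr_ge0 ?linfty_norm_ge0// ltW.
  by rewrite mulrAC mulVf ?mul1r// gt_eqF.
- move=> u v ub vb; split=> [uv|uv n].
    apply: filterS2 (step_classE a (c *: u)) (step_classE a (c *: v)).
    by move=> x -> ->; rewrite /step; case: ifP => // _; rewrite ler_pM2l.
  have [x [xa xn [uvx [ux vx]]]] := ex_piece _ n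
    (filterI uv (filterI (step_classE a (c *: u)) (step_classE a (c *: v)))).
  by move: uvx; rewrite ux vx /step xa xn ler_pM2l.
- move=> u v ub vb; split.
    apply: filterS3 (step_classE a (c *: u)) (step_classE a (c *: v))
      (step_classE a (c *: (u \max v))) => x -> -> ->.
    by rewrite /step; case: ifP => _; [exact: maxr_pMr (ltW c0)|rewrite maxxx].
  apply: filterS3 (step_classE a (c *: u)) (step_classE a (c *: v))
    (step_classE a (c *: (u \min v))) => x -> -> ->.
  by rewrite /step; case: ifP => _; [exact: minr_pMr (ltW c0)|rewrite minxx].
Qed.
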